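(* Let $X := \{(x,y)\in\mathbb{R}^2 \mid y>0\} \cup \{(x,0) \mid x\geq 0\}\subset\mathbb{R}^2$, equipped with its subspace Sikorski structure $\mathcal{F}_X$ induced from $\mathbb{R}^2$. Then $\mathcal{F}_X$ is not reflexive, i.e. $\Phi\Pi\mathcal{F}_X\neq\mathcal{F}_X$.
   Context: ''Smooth'' means $C^\infty$. A cartesian space is $\mathbb{R}^d$ for some $d\in\mathbb{N}$, with its standard smooth structure. Sikorski structures. A Sikorski structure on a set $X$ is a non-empty collection $\mathcal{F}_X$ of real-valued functions on $X$ such that, with $X$ equipped with the initial topology (the weakest topology making all functions in $\mathcal{F}_X$ continuous): (S1) if $f_1,\ldots,f_n\in\mathcal{F}_X$ and $g\in C^\infty(\mathbb{R}^n)$, then $g\circ(f_1,\ldots,f_n)\in\mathcal{F}_X$; (S2) given $f\colon X\to\mathbb{R}$, if for each point of $X$ there exist a neighbourhood $V$ and $g\in\mathcal{F}_X$ with $g|_V=f|_V$, then $f\in\mathcal{F}_X$. A map between Sikorski spaces $(X,\mathcal{F}_X)\to(Y,\mathcal{F}_Y)$ is Sikorski smooth if its composition with every function in $\mathcal{F}_Y$ is in $\mathcal{F}_X$. A manifold (in particular an open subset of a cartesian space) carries the Sikorski structure of all $C^\infty$ real-valued functions. For a subset $V$ of a Sikorski space $(X,\mathcal{F}_X)$, the subspace Sikorski structure is the set of functions $f\colon V\to\mathbb{R}$ such that each point of $V$ has a neighbourhood $W$ in $X$ and a function $g\in\mathcal{F}_X$ with $g|_{V\cap W}=f|_{V\cap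 W}$. Diffeologies. A diffeology on a set $X$ is a collection $\mathcal{D}_X$ of maps (plots) from open subsets of cartesian spaces to $X$ such that: (D1) constant maps are plots; (D2) precompositions of plots with $C^\infty$ maps between open subsets of cartesian spaces are plots; (D3) $p\colon U\to X$ is a plot if each point of $U$ has a neighbourhood $V$ with $p|_V$ a plot. A map between diffeological spaces is diffeologically smooth if its precomposition with every plot of the source is a plot of the target; a manifold carries the diffeology of all $C^\infty$ maps from open subsets of cartesian spaces. For a Sikorski structure $\mathcal{F}_X$, $\Pi\mathcal{F}_X$ denotes the diffeology of all Sikorski smooth maps from open subsets of cartesian spaces to $X$. For a diffeology $\mathcal{D}_X$, $\Phi\mathcal{D}_X$ denotes the Sikorski structure of all diffeologically smooth real-valued functions on $X$. A Sikorski structure $\mathcal{F}_X$ is reflexive if $\Phi\Pi\mathcal{F}_X=\mathcal{F}_X$. *)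

(* Defs.v *)
From HB Require Import structures.
From mathcomp Require Import all_boot all_order all_algebra.
From mathcomp Require Import all_classical all_reals all_analysis.
From mathcomp Require Import ring lra.

Set Implicit Arguments.
Unset Strict Implicit.
Unset Printing Implicit Defensive.

Import Order.TTheory GRing.Theory Num.Theory.
Import numFieldNormedType.Exports.

Local Open Scope classical_set_scope.
Local Open Scope ring_scope.

Definition partial (R : realType) (n : nat) (i : 'I_n) (f : 'rV[R]_n -> R) :
    'rV[R]_n -> R :=
  fun x => 'D_('e_i) f x.

(* [f] is of class C^k at the points of [U]; this is meant for open [U], and
   then only depends on the values of [f] on [U]. *)
Fixpoint Ck (R : realType) (n k : nat) (U : set 'rV[R]_n) (f : 'rV[R]_n -> R) :
    Prop :=
  (forall x, U x -> {for x, continuous f}) /\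
  if k is k'.+1 then
    forall i : 'I_n,
      (forall x, U x -> derivable f x ('e_i)) /\ Ck k' U (partial i f)
  else True.

Definition smooth_on (R : realType) (n : nat) (U : set 'rV[R]_n)
    (f : 'rV[R]_n -> R) : Prop :=
  forall k, Ck k U f.

Section Calculus.
Variable R : realType.

Lemma Ck_continuous n k (U : set 'rV[R]_n) f x :
  Ck k U f -> U x -> {for x, continuous f}.
Proof. by case: k => [|k] [+ _]; exact. Qed.

Lemma CkW n k (U : set 'rV[R]_n) f : Ck k.+1 U f -> Ck k U f.
Proof.
elim: k f => [|k IH] f [fc fd]; first by split.
by split=> // i; have [fdi /IH] := fd i.
Qed.

Lemma Ck_local n k (U : set 'rV[R]_n) f :
  (forall x, U x -> exists V g, [/\ open V, V x, Ck k V g &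
     forall y, V y -> g y = f y]) -> Ck k U f.
Proof.
have gfnear (V : set 'rV[R]_n) (g h : 'rV[R]_n -> R) x :
    open V -> V x -> (forall y, V y -> g y = h y) -> {near x, g =1 h}.
  move=> oV Vx gh; apply: filterS (open_nbhs_nbhs (conj oV Vx)) => y.
  exact: gh.
have gfc (V : set 'rV[R]_n) (g h : 'rV[R]_n -> R) x :
    open V -> V x -> (forall y, V y -> g y = h y) ->
    {for x, continuous g} -> {for x, continuous h}.
  move=> oV Vx gh gc; have := gfnear _ _ _ _ oV Vx gh => nr.
  rewrite /prop_for /continuous_at -(gh _ Vx).
  by apply: cvg_trans gc; apply: near_eq_cvg nr.
elim: k f => [|k IH] f fl; split.
- by move=> x /fl[V [g [oV Vx [gc _] gf]]]; apply: (gfc V g) => //; exact: gc.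
- by [].
- by move=> x /fl[V [g [oV Vx [gc _] gf]]]; apply: (gfc V g) => //; exact: gc.
- move=> i; split.
    move=> x /fl[V [g [oV Vx [_ gd] gf]]].
    apply: near_eq_derivable (gfnear _ _ _ _ oV Vx gf) _.
    by have [+ _] := gd i; exact.
  apply: IH => x /fl[V [g [oV Vx [_ gd] gf]]].
  exists V, (partial i g); split=> //; first by have [_ +] := gd i.
  by move=> y Vy; apply: near_eq_derive; exact: (gfnear _ _ _ _ oV Vy gf).
Qed.

Lemma Ck_eq n k (U : set 'rV[R]_n) f g :
  open U -> (forall x, U x -> f x = g x) -> Ck k U f -> Ck k U g.
Proof. by move=> oU fg fk; apply: Ck_local => x Ux; exists U, f. Qed.

Lemma CkS n k (U V : set 'rV[R]_n) f : U `<=` V -> Ck k V f -> Ck k U f.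
Proof.
move=> UV; elim: k f => [|k IH] f [fc fd]; split=> //.
- by move=> x /UV; exact: fc.
- by move=> x /UV; exact: fc.
- by move=> i; have [fdi /IH ?] := fd i; split=> // x /UV; exact: fdi.
Qed.

Lemma Ck_cst n k (U : set 'rV[R]_n) (c : R) : Ck k U (fun=> c).
Proof.
elim: k c => [|k IH] c; split=> //; try by move=> x _; exact: cst_continuous.
move=> i; split; first by move=> x _; exact: derivable_cst.
rewrite (_ : partial i _ = fun=> 0); first exact: IH.
by apply/funext => x; rewrite /partial derive_cst.
Qed.

Lemma smooth_coord n (U : set 'rV[R]_n) (i : 'I_n) :
  smooth_on U (fun x => x 0 i).
Proof.
have dc (x : 'rV[R]_n) : differentiable (fun y : 'rV[R]_n => y 0 i : R) x.
  exact: differentiable_coord.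
case=> [|k]; split=> //; try by move=> x _; exact: coord_continuous.
move=> j; split; first by move=> x _; exact: diff_derivable.
rewrite (_ : partial j _ = fun=> ('e_j : 'rV[R]_n) 0 i).
  exact: Ck_cst.
apply/funext => x; rewrite /partial.
have := @derive_mx R _ _ _ id x 'e_j (@derivable_id _ _ _ _).
by rewrite derive_id => /(congr1 (fun A : 'rV[R]_n => A 0 i)); rewrite [RHS]mxE.
Qed.

Lemma CkD n k (U : set 'rV[R]_n) f g :
  open U -> Ck k U f -> Ck k U g -> Ck k U (fun x => f x + g x).
Proof.
move=> oU; elim: k f g => [|k IH] f g [fc fd] [gc gd]; split=> //;
  try by move=> x Ux; apply: continuousD; [exact: fc|exact: gc].
move=> i; have [fdi fk] := fd i; have [gdi gk] := gd i; split.
  by move=> x Ux; apply: derivableD; [exact: fdi|exact: gdi].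
apply: Ck_eq oU _ (IH _ _ fk gk) => x Ux.
by rewrite /partial deriveD//; [exact: fdi|exact: gdi].
Qed.

Lemma CkM n k (U : set 'rV[R]_n) f g :
  open U -> Ck k U f -> Ck k U g -> Ck k U (fun x => f x * g x).
Proof.
move=> oU; elim: k f g => [|k IH] f g fC gC.
  have [fc _] := fC; have [gc _] := gC.
  by split=> // x Ux; apply: continuousM; [exact: fc|exact: gc].
have [fc fd] := fC; have [gc gd] := gC; split.
  by move=> x Ux; apply: continuousM; [exact: fc|exact: gc].
move=> i; have [fdi fk] := fd i; have [gdi gk] := gd i; split.
  by move=> x Ux; apply: derivableM; [exact: fdi|exact: gdi].
apply: Ck_eq oU _ (CkD oU (IH _ _ (CkW fC) gk) (IH _ _ (CkW gC) fk)) => x Ux.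
by rewrite /partial deriveM//; [exact: fdi|exact: gdi].
Qed.

Lemma Ck_sum n k (U : set 'rV[R]_n) m (f : 'I_m -> 'rV[R]_n -> R) :
  open U -> (forall j, Ck k U (f j)) -> Ck k U (fun x => \sum_j f j x).
Proof.
move=> oU fk; elim: m f fk => [|m IH] f fk.
  apply: Ck_eq oU _ (Ck_cst k U 0) => x _; by rewrite big_ord0.
apply: Ck_eq oU _ (CkD oU (IH (fun j => f (widen_ord (leqnSn m) j)) _) (fk ord_max)) => //.
by move=> x _; rewrite big_ord_recr.
Qed.

Lemma MVT_bound (phi dphi : R -> R) (s e : R) :
  (forall t : R, `|t| <= `|s| -> is_derive t 1 phi (dphi t) /\ `|dphi t| <= e) ->
  `|phi s - phi 0| <= e * `|s|.
Proof.
move=> H.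
have cont (a b : R) : `|a| <= `|s| -> `|b| <= `|s| ->
    {within `[a, b], continuous phi}.
  move=> ha hb; apply: derivable_within_continuous => t.
  rewrite in_itv /= => /andP[at_ tb].
  have [] := H t; last by move=> dt _; case: dt.
  rewrite ler_norml (le_trans _ at_) ?(le_trans tb)//.
    by rewrite (le_trans (ler_norm _)).
  by rewrite lerNl (le_trans _ ha)// -normrN ler_norm.
have [s0|s0] := leP 0 s.
  have [||c] := @MVT_segment R phi dphi 0 s s0; last first.
  - rewrite in_itv /= => /andP[c0 cs] ->; rewrite normrM subr0 ler_wpM2r//.
    by apply: (H c _).2; rewrite !ger0_norm.
  - by apply: cont; rewrite ?normr0 ?normr_ge0.
  - move=> t; rewrite in_itv /= => /andP[/ltW t0 /ltW ts]; apply: (H t _).1.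
    by rewrite !ger0_norm.
have [||c] := @MVT_segment R phi dphi s 0 (ltW s0); last first.
- rewrite in_itv /= => /andP[sc c0]; rewrite distrC => ->.
  rewrite normrM sub0r normrN ler_wpM2r//.
  by apply: (H c _).2; rewrite !ler0_norm ?lerN2// ltW.
- by apply: cont; rewrite ?normr0 ?normr_ge0.
- move=> t; rewrite in_itv /= => /andP[/ltW st /ltW t0]; apply: (H t _).1.
  by rewrite !ler0_norm ?lerN2// ltW.
Qed.

Lemma is_derive_line n (f : 'rV[R]_n -> R) (y v : 'rV[R]_n) (t : R) :
  derivable f (t *: v + y) v ->
  is_derive t 1 (fun s : R => f (s *: v + y)) ('D_v f (t *: v + y)).
Proof.
move=> fd.
have E : (fun h : R => h^-1 *: (((fun s : R => f (s *: v + y)) \o shift t) (h *: (1 : R))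
            - f (t *: v + y))) =
    (fun h => h^-1 *: ((f \o shift (t *: v + y)) (h *: v) - f (t *: v + y))).
  apply/funext => h /=; congr (_ *: (f _ - _)).
  by rewrite (_ : h *: 1 = h); [rewrite scalerDl addrA|exact: mulr1].
by apply: DeriveDef; rewrite /derivable /derive E.
Qed.

Lemma C1_differentiable n (U : set 'rV[R]_n) f x :
  open U -> Ck 1 U f -> U x -> differentiable f x.
Proof.
move=> oU [fc fd] Ux.
pose L (h : 'rV[R]_n) : R := \sum_j h 0 j * partial j f x.
have L_lin : linear L.
  move=> a u v; rewrite /L scaler_sumr -big_split/=; apply: eq_bigr => j _.
  by rewrite !mxE mulrDl /GRing.scale/= mulrA.
pose LM := GRing.isLinear.Build _ _ _ _ _ L_lin.
pose LL : {linear 'rV[R]_n -> R} := HB.pack L LM.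
have LC : continuous LL.
  move=> y; apply: (@Ck_continuous n 0 setT L y) => //.
  apply: Ck_sum; first exact: openT.
  move=> j; apply: CkM (Ck_cst 0 setT _); first exact: openT.
  exact: (@smooth_coord n setT j 0).
suff fL : f \o shift x = cst (f x) + LL +o_ (0 : 'rV[R]_n) id.
  by apply/diff_locallyP; rewrite (diff_unique LC fL).
apply/eqaddoP => _/posnumP[e].
pose e' := e%:num / n.+1%:R.
have e'0 : 0 < e' by rewrite divr_gt0.
have : \forall y \near x, U y /\ forall j, `|partial j f y - partial j f x| <= e'.
  apply: filterI; first exact: open_nbhs_nbhs.
  apply: (@filter_forall _ _ (fun (j : 'I_n) y => `|partial j f y - partial j f x| <= e') (nbhs x)) => j.
  have dc : Ck 0 U (partial j f) := (fd j).2.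
  have /cvgrPdist_le/(_ _ e'0) := Ck_continuous dc Ux.
  by apply: filterS => y; rewrite distrC.
move=> /nbhs_ballP[d /= d0 H].
apply/nbhs_ballP; exists d => // h /=.
rewrite -ball_normE /= sub0r normrN => hd.
pose hk k : 'rV[R]_n := \row_j (if (j < k)%N then h 0 j else 0).
have hcoord (j : 'I_n) : `|h 0 j| <= `|h|.
  by rewrite [leRHS]/Num.Def.normr/= mx_normrE; exact: (le_bigmax _ (fun ij => `|h ij.1 ij.2|) (0, j)).
have small (u : 'rV[R]_n) : (forall j, `|u 0 j| <= `|h|) -> `|u| <= `|h|.
  move=> uh; rewrite [leLHS]/Num.Def.normr/= mx_normrE bigmax_le// => -[i j] _ /=.
  by rewrite ord1.
have claim k : (k <= n)%N ->
    `|f (hk k + x) - f x - \sum_(j < n | (j < k)%N) h 0 j * partial j f x|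
      <= k%:R * e' * `|h|.
  elim: k => [_|k IH kn].
    rewrite big1// (_ : hk 0%N = 0) ?add0r ?subrr ?subr0 ?normr0 ?mul0r//.
    by apply/matrixP => a j; rewrite !mxE.
  pose i : 'I_n := Ordinal kn.
  pose y := hk k + x.
  pose phi (t : R) : R := f (t *: 'e_i + y) - t * partial i f x.
  have hkS : hk k.+1 + x = h 0 i *: 'e_i + y.
    rewrite /y addrA; congr (_ + _); apply/matrixP => a j.
    rewrite !mxE ord1 eqxx /= ltnS leq_eqVlt.
    have [->|ji] := eqVneq j i; first by rewrite /= eqxx ltnn /= mulr1 addr0.
    rewrite (_ : (j == k :> nat) = false) /= ?mulr0 ?add0r//.
    by apply: contra_neqF ji => /eqP ji; apply/val_inj.
  have : `|phi (h 0 i) - phi 0| <= e' * `|h 0 i|.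
    apply: (@MVT_bound _ (fun t => partial i f (t *: 'e_i + y) - partial i f x)) => t th.
    have [Uy Hy] : U (t *: 'e_i + y) /\
        forall j, `|partial j f (t *: 'e_i + y) - partial j f x| <= e'.
      apply: H; rewrite -ball_normE /= /y addrA opprD addrCA subrr addr0 normrN.
      apply: le_lt_trans hd; apply: small => j; rewrite !mxE eqxx /=.
      have [->|ji] := eqVneq j i.
        by rewrite /= ltnn mulr1 addr0 (le_trans th).
      by rewrite mulr0 add0r; case: ifP => // _; rewrite normr0.
    split=> //.
    have [+ _] := fd i => /(_ _ Uy) /is_derive_line d1.
    have d2 : is_derive t 1 (fun s : R => s * partial i f x) (partial i f x).
      apply: is_derive_eq (is_deriveM (is_derive_id t (1 : R))
        (is_derive_cst (partial i f x) t (1 : R))) _.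
      by rewrite scaler0 add0r; exact: mulr1.
    exact: is_deriveB d1 d2.
  rewrite /phi mul0r subr0 scale0r add0r -hkS => step.
  rewrite (bigD1 i)//=.
  rewrite (eq_bigl (fun j : 'I_n => (j < k)%N)); last first.
    move=> j; rewrite ltnS leq_eqVlt -(inj_eq val_inj)/=.
    by have [->|_] := eqVneq (j : nat) k; rewrite ?ltnn ?andbT.
  set F1 := f (hk k.+1 + x) in step *; set S := \sum_(_ < _ | _) _ in IH *.
  rewrite (_ : _ - _ = (F1 - h 0 i * partial i f x - f y) + (f y - f x - S));
    last by ring.
  rewrite (le_trans (ler_normD _ _))// -natr1 addrC mulrDl mul1r mulrDl lerD//.
    by rewrite IH// ltnW.
  by rewrite (le_trans step)// ler_wpM2l// ltW.
have := claim n (leqnn n).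
rewrite (_ : hk n = h); last by apply/matrixP => a j; rewrite mxE ltn_ord ord1.
rewrite (eq_bigl predT); last by move=> j; rewrite ltn_ord.
rewrite -[\sum_(_ < _ | _) _]/(LL h) -[f (h + x)]/((f \o shift x) h).
rewrite -addrA -opprD => /le_trans; apply; rewrite ler_wpM2r//.
rewrite /e' mulrCA ler_piMr// ler_pdivrMr ?mul1r ?ler_nat//.
Qed.

Lemma Ck_comp n m k (U : set 'rV[R]_n) (V : set 'rV[R]_m)
    (f : 'rV[R]_n -> R) (g : 'I_n -> 'rV[R]_m -> R) :
  open U -> open V -> Ck k U f -> (forall i, Ck k V (g i)) ->
  (forall y, V y -> U (\row_i g i y)) ->
  Ck k V (fun y => f (\row_i g i y)).
Proof.
move=> oU oV fk gk VU.
have cont k' (f' : 'rV[R]_n -> R) : Ck k' U f' ->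
    forall y, V y -> {for y, continuous (fun y => f' (\row_i g i y))}.
  move=> f'k y Vy.
  have gc : {for y, continuous (fun y : 'rV[R]_m => (\row_i g i y : 'rV[R]_n))}.
    apply/(@cvgrPdist_le R 'rV[R]_n _ (nbhs y) (nbhs_filter y)) => e e0.
    have gi i : \forall z \near y, `|g i y - g i z| <= e.
      by have /cvgrPdist_le/(_ _ e0) := Ck_continuous (gk i) Vy.
    apply: (@filterS _ (nbhs y) (nbhs_filter y) _ _ _ (filter_forall (nbhs_filter y) gi)) => z ze.
    rewrite [leLHS]/Num.Def.normr/= mx_normrE bigmax_le ?(ltW e0)// => -[a i] _ /=.
    by rewrite !mxE.
  apply: (@continuous_comp _ _ _ (fun y => \row_i g i y) f') => //.
  by apply: (Ck_continuous f'k); exact: VU.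
elim: k f fk gk cont => [|k IH] f fk gk cont; split=> //.
- exact: cont fk.
- exact: cont fk.
have gC1 i : Ck 1 V (g i).
  by elim: (k) (gk i) => // k' IHk /CkW.
have fC1 : Ck 1 U f by elim: (k) fk => // k' IHk /CkW.
move=> i.
have gd y : V y -> differentiable (fun y => \row_i g i y) y.
  move=> Vy.
  rewrite (_ : (fun y => _) = \sum_j (fun y => g j y *: 'e_j)); last first.
    apply/funext => z; apply/matrixP => a b; rewrite fct_sumE summxE ord1 !mxE.
    rewrite (bigD1 b)//= !mxE !eqxx mulr1 big1 ?addr0// => j jb.
    by rewrite !mxE eqxx (eq_sym b) (negbTE jb) mulr0.
  apply: differentiable_sum => j; apply: differentiableZl.
  exact: C1_differentiable oV (gC1 j) Vy.
have fdiff y : V y -> differentiable f (\row_i g i y).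
  by move=> /VU Uy; exact: C1_differentiable oU fC1 Uy.
have dfg y : V y -> differentiable (f \o (fun y => \row_i g i y)) y.
  by move=> Vy; exact: (differentiable_comp (gd y Vy) (fdiff y Vy)).
split; first by move=> y Vy; apply: diff_derivable; exact: dfg.
apply: (@Ck_eq m k V
  (fun y => \sum_j partial j f (\row_i g i y) * partial i (g j) y)) => //.
  move=> y Vy; rewrite /partial [RHS](deriveE _ (dfg y Vy)).
  rewrite (diff_comp (gd y Vy) (fdiff y Vy)) /= -(deriveE _ (gd y Vy)).
  rewrite derive_mx; last exact: diff_derivable (gd y Vy).
  rewrite [X in _ = 'd f _ X]row_sum_delta linear_sum; apply: eq_bigr => j _.
  rewrite linearZ/= -(deriveE _ (fdiff y Vy)) mxE mulrC; congr (_ * _).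
  by congr ('D_('e_i) _ y); apply/funext => z; rewrite mxE.
apply: Ck_sum => // j; apply: CkM => //; last by have [_ /(_ i)[]] := gk j.
by apply: IH => //; [have [_ /(_ j)[]] := fk|move=> j'; exact: CkW].
Qed.

Lemma smooth_comp n m (U : set 'rV[R]_n) (V : set 'rV[R]_m)
    (f : 'rV[R]_n -> R) (g : 'I_n -> 'rV[R]_m -> R) :
  open U -> open V -> smooth_on U f -> (forall i, smooth_on V (g i)) ->
  (forall y, V y -> U (\row_i g i y)) ->
  smooth_on V (fun y => f (\row_i g i y)).
Proof. by move=> oU oV fs gs VU k; apply: Ck_comp (fs k) _ VU => // i; exact: gs. Qed.
End Calculus.

Record opens (R : realType) (n : nat) := Opens {
  opens_set :> set 'rV[R]_n;
  opensP : open opens_set }.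

Definition inclusion (T : Type) (V U : set T) (VU : V `<=` U) (v : V) : U :=
  exist _ (val v) (mem_set (VU _ (set_valP v))).

(* [g] only serves to give [f : U -> R] values outside of the open set [U], so
   that [Ck] applies; [g] is not required to be smooth, or even continuous,
   there. *)
Definition smooth_fun (R : realType) (n : nat) (U : opens R n) : set (U -> R) :=
  [set f | exists2 g : 'rV[R]_n -> R, smooth_on U g & forall u, f u = g (val u)].

Definition smooth_map (R : realType) (m n : nat) (V : opens R m) (U : opens R n)
    (h : V -> U) : Prop :=
  forall i : 'I_n, smooth_fun (fun v => val (h v) 0 i).

Definition sikorski_topology (R : realType) (X : choiceType)
    (F : set (X -> R)) : topologicalType :=
  sup_topology (fun f : F => Topological.on (initial_topology (val f))).

Record sikorski (R : realType) (X : choiceType) := Sikorski {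
  sikorski_fun :> set (X -> R);
  sikorski_neq0 : sikorski_fun !=set0;
  sikorski_comp : forall n (f : 'I_n -> X -> R) (g : 'rV[R]_n -> R),
    (forall i, sikorski_fun (f i)) -> smooth_on setT g ->
    sikorski_fun (fun x => g (\row_i f i x));
  sikorski_local : forall f : X -> R,
    (forall x : sikorski_topology sikorski_fun, exists V g,
      [/\ nbhs x V, sikorski_fun g & forall y, V y -> g y = f y]) ->
    sikorski_fun f }.

(* [plot U] is the set of plots with domain [U]; in [plot_local] the
   neighbourhood [V] is open since only then can the restriction be a plot. *)
Record diffeology (R : realType) (X : Type) := Diffeology {
  plot : forall (n : nat) (U : opens R n), set (U -> X);
  plot_cst : forall n (U : opens R n) (x : X), plot (fun _ : U => x);
  plot_comp : forall m n (U : opens R n) (V : opens R m) (p : U -> X)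
    (h : V -> U), plot p -> smooth_map h -> plot (p \o h);
  plot_local : forall n (U : opens R n) (p : U -> X),
    (forall u : U, exists V : opens R n, opens_set V (val u) /\
      exists VU : V `<=` U, plot (p \o inclusion VU)) ->
    plot p }.

Definition sikorski_smooth (R : realType) (X Y : choiceType)
    (F : sikorski R X) (G : sikorski R Y) (h : X -> Y) : Prop :=
  forall g, sikorski_fun G g -> sikorski_fun F (g \o h).

Definition diffeologically_smooth (R : realType) (X Y : Type)
    (D : diffeology R X) (E : diffeology R Y) (h : X -> Y) : Prop :=
  forall n (U : opens R n) (p : U -> X), plot D p -> plot E (h \o p).

Section Structures.
Variable R : realType.

Lemma smooth_on_cst n (U : set 'rV[R]_n) (c : R) : smooth_on U (fun=> c).
Proof. by move=> k; exact: Ck_cst. Qed.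

Lemma nbhs_initialP (S : choiceType) (T : topologicalType) (f : S -> T)
    (s : initial_topology f) (O : set S) :
  nbhs s O -> exists2 W : set T, open_nbhs (f s) W & f @^-1` W `<=` O.
Proof. by rewrite nbhsE => -[B [[W oW <-] Ws] WO]; exists W. Qed.

Lemma sikorski_nbhs (X : choiceType) (F : set (X -> R)) (G : set_system X)
    (x : sikorski_topology F) (V : set X) :
  Filter G -> (forall f, F f -> f y @[y --> G] --> f x) -> nbhs x V -> G V.
Proof.
move=> FG Gf; have : G --> x.
  apply/cvg_sup => -[f fF] O /nbhs_initialP[W oW WO].
  exact: (filterS WO (Gf f (set_mem fF) W (open_nbhs_nbhs oW))).
exact.
Qed.

Lemma nbhs_sub (T : topologicalType) (U : set T) (u : U) (O : set U) :
  nbhs u O -> exists2 W, open_nbhs (val u) W & forall w : U, W (val w) -> O w.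
Proof. by move=> /nbhs_initialP[W ? ?]; exists W. Qed.

Lemma sub_continuous (T S : topologicalType) (U : set T) (f : T -> S) (u : U) :
  {for val u, continuous f} -> f (val w) @[w --> u] --> f (val u).
Proof.
move=> fc; have vc : val w @[w --> u] --> val u.
  by move=> A; rewrite nbhsE => -[W [oW Wu] WA]; exists (val @^-1` W); split=> //;
    [exists W|move=> w /WA].
exact: cvg_comp vc fc.
Qed.

Section SmoothFun.
Variables (n : nat) (U : opens R n).

Lemma smooth_fun_continuous (f : U -> R) (u : U) :
  smooth_fun f -> f w @[w --> u] --> f u.
Proof.
move=> [g gs fg]; rewrite (_ : f = fun w => g (val w)); last exact/funext.
apply: (@sub_continuous _ _ U g u); apply: (Ck_continuous (gs 0)); exact: set_valP.
Qed.

Lemma smooth_fun_local (f : U -> R) :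
  (forall u : U, exists (V : set 'rV[R]_n) g, [/\ open V, V (val u), smooth_on V g &
     forall w : U, V (val w) -> f w = g (val w)]) -> smooth_fun f.
Proof.
move=> fl.
pose h x := if pselect (opens_set U x) is left Ux then f (exist _ x (mem_set Ux)) else 0.
have hE u : h (val u) = f u.
  rewrite /h; case: pselect => [Uu|]; last by have := set_valP u.
  by congr f; exact/val_inj.
exists h => // k; apply: Ck_local => x Ux.
have [V [g [oV Vx gs fg]]] := fl (exist _ x (mem_set Ux)).
exists (V `&` U), g; split=> //; first by apply: openI => //; exact: opensP.
  by apply: CkS (gs k); exact: subIsetl.
by move=> y [Vy Uy]; have := hE (exist _ y (mem_set Uy)) => /= ->; rewrite fg.
Qed.

Lemma smooth_fun_cst (c : R) : smooth_fun (fun _ : U => c).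
Proof. by exists (fun=> c) => //; exact: smooth_on_cst. Qed.

Lemma smooth_fun_comp m (W : opens R m) (f : 'I_m -> U -> R) (g : 'rV[R]_m -> R) :
  (forall i, smooth_fun (f i)) -> smooth_on W g ->
  (forall u, opens_set W (\row_i f i u)) -> smooth_fun (fun u => g (\row_i f i u)).
Proof.
move=> fs gs fW.
have /choice[F Fs] : forall i, exists F, smooth_on U F /\
    forall u, f i u = F (val u).
  by move=> i; have [F] := fs i; exists F.
have FE u : \row_i F i (val u) = \row_i f i u.
  by apply/rowP => i; rewrite !mxE; have [_ ->] := Fs i.
exists (fun x => g (\row_i F i x)); last by move=> u; rewrite FE.
apply: smooth_comp gs _ _; [exact: opensP|exact: opensP| |].
  by move=> i; have [] := Fs i.
by move=> y Uy; have := FE (exist _ y (mem_set Uy)) => /= ->.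
Qed.

End SmoothFun.

Lemma smooth_fun_precomp m n (U : opens R n) (V : opens R m) (f : U -> R)
  (h : V -> U) : smooth_fun f -> smooth_map h -> smooth_fun (f \o h).
Proof.
move=> [g gs fg] hs.
have hE v : \row_i val (h v) 0 i = val (h v).
  by apply/rowP => i; rewrite mxE.
rewrite (_ : f \o h = fun v => g (\row_i val (h v) 0 i)); last first.
  by apply/funext => v; rewrite hE -fg.
by apply: (smooth_fun_comp hs gs) => v; rewrite hE; exact: set_valP.
Qed.

Lemma smooth_fun_local_incl n (U : opens R n) (f : U -> R) :
  (forall u : U, exists V : opens R n, opens_set V (val u) /\
     exists VU : V `<=` U, smooth_fun (f \o inclusion VU)) -> smooth_fun f.
Proof.
move=> fl; apply: smooth_fun_local => u.
have [V [Vu [VU [g gs fg]]]] := fl u.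
exists V, g; split=> //; first exact: opensP.
move=> w Vw; have := fg (exist _ (val w) (mem_set Vw)) => /= <-.
by congr f; exact/val_inj.
Qed.

Program Definition cartesian_sikorski (n : nat) : sikorski R 'rV[R]_n :=
  @Sikorski R 'rV[R]_n [set f | smooth_on setT f] _ _ _.
Next Obligation. by move=> n; exists (fun=> 0); exact: smooth_on_cst. Qed.
Next Obligation.
by move=> n m f g fs gs; apply: smooth_comp gs fs _ => //; exact: openT.
Qed.
Next Obligation.
move=> n f fl k; apply: Ck_local => x _.
have [V [g [Vx gs gf]]] := fl x.
have : nbhs (x : 'rV[R]_n) V.
  apply: (@sikorski_nbhs _ _ (nbhs (x : 'rV[R]_n)) x) Vx => h hs.
  exact: (Ck_continuous (hs 0)).
rewrite nbhsE => -[W [oW Wx] WV]; exists W, g; split=> //.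
  exact: CkS (gs k).
by move=> y /WV; exact: gf.
Qed.

Program Definition open_sikorski (n : nat) (U : opens R n) : sikorski R U :=
  @Sikorski R U (@smooth_fun R n U) _ _ _.
Next Obligation. by move=> n U; exists (fun=> 0); exact: smooth_fun_cst. Qed.
Next Obligation.
move=> n U m f g fs gs.
exact: (@smooth_fun_comp _ _ _ (Opens openT)).
Qed.
Next Obligation.
move=> n U f fl; apply: smooth_fun_local => u.
have [V [g [Vu [h hs gh] gf]]] := fl u.
have /nbhs_sub[W [oW Wu] WV] : nbhs (u : (U : set _)) V.
  apply: (@sikorski_nbhs _ _ (nbhs (u : (U : set _))) u) Vu => f' f's.
  exact: smooth_fun_continuous.
exists (W `&` U), h; split=> //.
- by apply: openI => //; exact: opensP.
- by split=> //; exact: set_valP.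
- by move=> k; apply: CkS (hs k); exact: subIsetr.
- by move=> w [/WV Vw _]; rewrite -gf// gh.
Qed.

Program Definition sub_sikorski (X : choiceType) (F : sikorski R X)
    (V : set X) : sikorski R V :=
  @Sikorski R V [set f | forall v : V, exists W g,
    [/\ nbhs (val v : sikorski_topology F) W, sikorski_fun F g &
        forall w : V, W (val w) -> g (val w) = f w]] _ _ _.
Next Obligation.
move=> X F V; have [g Fg] := sikorski_neq0 F; exists (g \o val) => v.
by exists setT, g; split=> //; exact: filterT.
Qed.
Next Obligation.
move=> X F V n f g fs gs v.
have [W fW] := choice (fun i => fs i v).
have [h fh] := choice fW.
exists [set x | forall i, W i x], (fun x => g (\row_i h i x)); split.
- have Wv i : nbhs (val v : sikorski_topology F) (W i) by have [] := fh i.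
  exact: (filter_forall (nbhs_filter _) Wv).
- by apply: sikorski_comp => // i; have [] := fh i.
- move=> w Ww; congr g; apply/rowP => i; rewrite !mxE.
  by have [_ _ ->] := fh i.
Qed.
Next Obligation.
move=> X F V f fl v.
have [A [g [Av gs gf]]] := fl v.
pose val' : V -> sikorski_topology F := val.
have /nbhs_initialP[W Wv WA] : nbhs (v : initial_topology val') A.
  apply: (@sikorski_nbhs _ _ (nbhs (v : initial_topology val')) v) Av => f' f's.
  have [W' [h [W'v Fh hf']]] := f's v.
  have hcont : h y @[y --> val' v] --> h (val' v).
    have /cvg_sup/(_ (exist _ h (mem_set Fh))) hv : nbhs (val' v) --> val' v by [].
    move=> B /(@initial_continuous _ _ h (val' v)); exact: hv.
  have vcont : val' w @[w --> (v : initial_topology val')] --> val' v.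
    exact: (@initial_continuous _ _ val' v).
  rewrite -(hf' v); last exact: nbhs_singleton W'v.
  have : (h \o val') w @[w --> (v : initial_topology val')] --> h (val' v).
    exact: cvg_comp vcont hcont.
  apply: cvg_trans; apply: near_eq_cvg.
  have sub : val' @^-1` W' `<=` [set w | h (val w) = f' w] by move=> w; exact: hf'.
  exact: (filterS sub (vcont _ W'v)).
have [W' [h [W'v Fh hg]]] := gs v.
exists (W `&` W'), h; split=> //.
  by apply: filterI => //; exact: open_nbhs_nbhs.
by move=> w [/WA Aw W'w]; rewrite hg// gf.
Qed.

Program Definition real_diffeology : diffeology R R :=
  @Diffeology R R (@smooth_fun R) _ _ _.
Next Obligation. exact: smooth_fun_cst. Qed.
Next Obligation. exact: smooth_fun_precomp. Qed.
Next Obligation. exact: smooth_fun_local_incl. Qed.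

Program Definition Pi (X : choiceType) (F : sikorski R X) : diffeology R X :=
  @Diffeology R X (fun n U => [set p | sikorski_smooth (open_sikorski U) F p])
    _ _ _.
Next Obligation. by move=> X F n U x g Fg; exact: smooth_fun_cst. Qed.
Next Obligation.
move=> X F m n U V p h ps hs g Fg.
by apply: (@smooth_fun_precomp _ _ _ _ (g \o p)) => //; exact: ps.
Qed.
Next Obligation.
move=> X F n U p pl g Fg; apply: smooth_fun_local_incl => u.
have [V [Vu [VU pV]]] := pl u.
by exists V; split=> //; exists VU; exact: pV.
Qed.

Program Definition Phi (X : choiceType) (D : diffeology R X) : sikorski R X :=
  @Sikorski R X [set f | diffeologically_smooth D real_diffeology f] _ _ _.
Next Obligation.
by move=> X D; exists (fun=> 0) => n U p _; exact: smooth_fun_cst.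
Qed.
Next Obligation.
move=> X D m f g fs gs n U p pD.
by apply: (@smooth_fun_comp _ _ _ (Opens openT) (fun i => f i \o p)) => // i; exact: fs.
Qed.
Next Obligation.
move=> X D f fl n U p pD; apply: smooth_fun_local => u.
have [V [g [Vu gs gf]]] := fl (p u).
have [h hs gh] := gs _ _ _ pD.
have /nbhs_sub[W [oW Wu] WV] : nbhs (u : (U : set _)) (p @^-1` V).
  have pF := fmap_filter p (nbhs_filter (u : (U : set _))).
  apply: (sikorski_nbhs pF _ Vu) => f' f's.
  by apply: (@smooth_fun_continuous _ _ (f' \o p)); exact: f's.
exists (W `&` U), h; split=> //.
- by apply: openI => //; exact: opensP.
- by split=> //; exact: set_valP.
- by move=> k; apply: CkS (hs k); exact: subIsetr.
- by move=> w [/WV Vw _]; rewrite -gh/= gf.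
Qed.

Definition sikorski_reflexive (X : choiceType) (F : sikorski R X) : Prop :=
  Phi (Pi F) = F :> set (X -> R).

(* The point (x, y) is the row vector [v] with [v 0 0 = x] and [v 0 1 = y]. *)
Definition half_plane : set 'rV[R]_2 :=
  [set v : 'rV[R]_2 | 0 < v 0 1] `|` [set v : 'rV[R]_2 | v 0 1 = 0 /\ 0 <= v 0 0].

End Structures.

Arguments half_plane : clear implicits.

(* Main.v *)
Require Import Defs.
From mathcomp Require Import all_boot all_order all_algebra.
From mathcomp Require Import all_classical all_reals all_analysis.
From mathcomp Require Import ring lra.

Set Implicit Arguments.
Unset Strict Implicit.
Unset Printing Implicit Defensive.

Import Order.TTheory GRing.Theory Num.Theory.
Import numFieldNormedType.Exports.

Local Open Scope classical_set_scope.
Local Open Scope ring_scope.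

(** The witness is [f(x, y) = (y exp(-y))^(1/|x|)] for [x < 0], extended by zero
    to [x >= 0]. Two facts about it contradict reflexivity.

    It is smooth along every plot of the half plane. Write a plot as [(a, b)],
    so that [b > 0] wherever [a < 0], and let [L = b - ln b]. Partial derivatives
    of [f] along the plot are combinations, with smooth coefficients, of
    functions [b^-i a^-j L^l exp(L / a)], again set to zero for [a >= 0], and
    these functions are closed under differentiation ([is_derive_flat]). Where
    [a < 0] this is the chain rule. Where [a] vanishes, the exponential wins over
    all the other factors, uniformly in [b]: since [L >= 1] and both [1 / b] and
    [L] are at most [exp L], the absolute value is [O(a^2)] as [a] tends to
    zero ([flat_bound]). So the function tends to zero, and so does its
    derivative, [a] being differentiable. Induction on the order gives
    smoothness ([Ck_flat]).

    It is not near the origin the restriction of a smooth function on the plane.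
    Every neighbourhood of the origin meets a vertical line [x = -1 / al] where
    [al] is half an odd integer, and on it [f = y^al exp(-al y)] for [y > 0]: a
    half-integral power of [y], which has no smooth extension through [y = 0]
    ([half_power_not_smooth]). The missing negative half of the axis is essential
    here: the point where the extension fails is not in the space, no plot
    reaches it, and yet such points accumulate at the origin. For each order the
    derivatives of [f] are bounded close enough to the origin, but no
    neighbourhood serves all orders at once. *)

(** * A family of functions flat along the line a = 0 *)

Section Flat.
Variable R : realType.
Implicit Types (a b : R) (i j l : nat).

(** The factors in front of the exponential are those that differentiation
    brings down; zero indices give the witness. Inverses are powers of [b^-1] and
    [a^-1] so that all products below are polynomial in these. *)
Definition flat i j l a b : R :=
  if a < 0 then
    b^-1 ^+ i * a^-1 ^+ j * (b - ln b) ^+ l * expR ((b - ln b) * a^-1)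
  else 0.

Lemma flat_ge0 i j l a b : 0 <= a -> flat i j l a b = 0.
Proof. by rewrite /flat ltNge => ->. Qed.

Lemma subr_ln_ge1 b : 0 < b -> 1 <= b - ln b.
Proof.
by move=> b0; have := @le_ln1Dx R (b - 1); rewrite addrCA subrr addr0 => H; lra.
Qed.

(** With [t = -1 / a >= i + l], the factors in [b] amount to at most
    [exp((i + l) L)], so the value is at most
    [t^j exp(-(t - i - l) L) <= exp(i + l) t^j exp(-t)], using [L >= 1];
    finally [t^(j + 2) <= (j + 2)! exp t]. The constant is independent of [b],
    which may tend to zero at any rate relative to [a]. *)
Lemma flat_bound i j l : exists2 C, 0 <= C & forall a b,
  - (i + l).+1%:R^-1 < a -> (a < 0 -> 0 < b) -> `|flat i j l a b| <= C * a ^+ 2.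
Proof.
exists (expR (i + l)%:R * (j.+2)`!%:R) => [|a b].
  by rewrite mulr_ge0 ?expR_ge0 ?ler0n.
have [a0 _ _|a0 ha b0] := leP 0 a.
  by rewrite flat_ge0// normr0 !mulr_ge0 ?expR_ge0 ?ler0n ?sqr_ge0.
have {}b0 := b0 isT.
set L := b - ln b; set t := - a^-1.
have L1 : 1 <= L by exact: subr_ln_ge1.
have t0 : 0 < t by rewrite oppr_gt0 invr_lt0.
have tE : a^-1 = - t by rewrite opprK.
have il : (i + l)%:R <= t.
  rewrite (@le_trans _ _ (i + l).+1%:R) ?ler_nat// /t -invrN.
  rewrite -[leLHS]invrK lef_pV2 ?posrE ?invr_gt0 ?oppr_gt0//.
  by rewrite lerNl ltW.
have bL : b^-1 <= expR L.
  rewrite -[b^-1]lnK ?posrE ?invr_gt0// ler_expR lnV ?posrE// /L.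
  by rewrite lerDr ltW.
have LL : L <= expR L by rewrite (le_trans _ (expR_ge1Dx L))// lerDr.
have tj : t ^+ j.+2 <= (j.+2)`!%:R * expR t.
  rewrite -ler_pdivrMl ?ltr0n ?fact_gt0// mulrC.
  by apply: le_trans (expR_ge1Dxn j.+1 (ltW t0)); rewrite lerDr.
rewrite /flat a0 -/L !normrM !normrX tE normrN mulrN.
rewrite (gtr0_norm t0) (@ger0_norm _ b^-1) ?invr_ge0 ?(ltW b0)//.
rewrite (@ger0_norm _ L) ?(le_trans _ L1)// ger0_norm ?expR_ge0//.
have -> : a ^+ 2 = t^-1 ^+ 2 by rewrite /t invrN invrK sqrrN.
rewrite -[leLHS](@mulfK _ (t ^+ 2)) ?expf_neq0 ?gt_eqF// [t^-1 ^+ 2]exprVn.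
rewrite ler_wpM2r ?invr_ge0 ?exprn_ge0 ?(ltW t0)//.
rewrite (_ : _ * t ^+ 2 = b^-1 ^+ i * L ^+ l * (t ^+ j.+2 * expR (- (L * t)))); last first.
  by rewrite -[j.+2]/(2 + j)%N exprD; ring.
have e1 : b^-1 ^+ i * L ^+ l <= expR L ^+ (i + l).
  rewrite exprD ler_pM ?exprn_ge0 ?invr_ge0 ?(le_trans _ L1) ?(ltW b0)//.
    by apply: lerXn2r; rewrite ?nnegrE ?expR_ge0 ?invr_ge0// ltW.
  by apply: lerXn2r; rewrite ?nnegrE ?expR_ge0 ?(le_trans _ L1).
have e2 : t ^+ j.+2 * expR (- (L * t)) <= (j.+2)`!%:R * expR t * expR (- (L * t)).
  by rewrite ler_wpM2r ?expR_ge0.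
apply: le_trans (ler_pM _ _ e1 e2) _.
- by rewrite mulr_ge0// exprn_ge0 ?invr_ge0 ?(le_trans _ L1)// ltW.
- by rewrite mulr_ge0 ?expR_ge0 ?exprn_ge0 ?(ltW t0).
rewrite [leLHS](_ : _ = (j.+2)`!%:R * (expR L ^+ (i + l) * expR t * expR (- (L * t))));
  last by ring.
rewrite [leRHS]mulrC ler_wpM2l ?ler0n// -expRM_natl -!expRD ler_expR.
by nra.
Qed.

(** The product rule with [L' = b' (1 - b^-1)], where [a'] and [b'] stand for the
    derivatives of [a] and [b]. The predecessor [l.-1] is harmless at
    [l = 0] because of the coefficient [l%:R]. *)
Definition flat_derive i j l a b a' b' : R :=
  b' * (- i%:R * flat i.+1 j l a b + l%:R * flat i j l.-1 a b
        - l%:R * flat i.+1 j l.-1 a b + flat i j.+1 l a b - flat i.+1 j.+1 l a b)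
  - a' * (j%:R * flat i j.+1 l a b + flat i j.+2 l.+1 a b).

Lemma is_derive_flat_lt0 i j l (a b : R -> R) (t a' b' : R) :
  is_derive t 1 a a' -> is_derive t 1 b b' -> a t < 0 -> 0 < b t ->
  is_derive t 1 (fun s => flat i j l (a s) (b s))
    (flat_derive i j l (a t) (b t) a' b').
Proof.
move=> da db a0 b0.
have acont : {for t, continuous a}.
  by apply/differentiable_continuous/derivable1_diffP; case: da.
have nearE : \near t, ((fun s => (b s)^-1) ^+ i * (fun s => (a s)^-1) ^+ j
    * (b - (ln (R := R) \o b)) ^+ l
    * (expR (R := R) \o ((b - (ln (R := R) \o b)) * (fun s => (a s)^-1)))) t
    = flat i j l (a t) (b t).
  have : \forall s \near t, a s < 0.
    exact: (acont [set y | y < 0] (lt_nbhsl a0)).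
  apply: filterS => s as0.
  by rewrite /flat as0 !fctE.
apply: (near_eq_is_derive nearE).
have dA := is_deriveV (ltr0_neq0 a0) da.
have dB := is_deriveV (lt0r_neq0 b0) db.
have dL := is_deriveB db (is_derive1_comp (is_derive1_ln b0) db).
have dE := is_derive1_comp (is_derive_expR _) (is_deriveM dL dA).
apply: is_derive_eq (is_deriveM (is_deriveM (is_deriveM (is_deriveX i dB)
  (is_deriveX j dA)) (is_deriveX l dL)) dE) _.
rewrite /flat_derive /flat a0 /GRing.scale /= !fctE -!exprVn.
move: (b t - ln (b t)) (b t)^-1 (a t)^-1 (expR _) => L q p E.
by case: i j l {nearE} => [|i] [|j] [|l] /=; rewrite ?exprS ?expr0 -?[_.+1%:R]natr1; ring.
Qed.

(** When [a t = 0] the difference quotient is at most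
    [C a(t + h)^2 / |h|], the product of the bounded [|a(t + h) / h|] and of
    [|a(t + h)|], which tends to zero. *)
Lemma is_derive_flat_ge0 i j l (a b : R -> R) (t a' : R) :
  is_derive t 1 a a' -> (\forall s \near t, a s < 0 -> 0 < b s) -> 0 <= a t ->
  is_derive t 1 (fun s => flat i j l (a s) (b s)) 0.
Proof.
move=> da ab a0.
have acont : {for t, continuous a}.
  by apply/differentiable_continuous/derivable1_diffP; case: da.
have [C C0 HC] := flat_bound i j l.
move: a0; rewrite le_eqVlt => /orP[/eqP a0|a0]; last first.
  apply: near_eq_is_derive (is_derive_cst 0 t 1).
  have : \forall s \near t, 0 < a s by exact: (acont [set y | 0 < y] (lt_nbhsr a0)).
  by apply: filterS => s as0; rewrite flat_ge0// ltW.
suff H : h^-1 *: (flat i j l (a (h *: (1 : R) + t)) (b (h *: (1 : R) + t))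
    - flat i j l (a t) (b t)) @[h --> (0 : R)^'] --> (0 : R).
  by apply: DeriveDef; [apply/cvg_ex; exists 0; exact: H|exact: cvg_lim H].
rewrite flat_ge0 -?a0//.
have shift0 : h *: (1 : R) + t @[h --> (0 : R)^'] --> t.
  rewrite -[X in _ --> X](add0r t) -[X in _ --> X + _](scale0r (1 : R)).
  apply: cvgD; last exact: cvg_cst.
  by apply: cvgZr_tmp; exact: nbhs_dnbhs.
have a_lim : a (h *: (1 : R) + t) @[h --> (0 : R)^'] --> 0.
  by rewrite [X in _ --> X]a0; exact: cvg_comp shift0 acont.
have da_lim : h^-1 *: (a (h *: (1 : R) + t) - a t) @[h --> (0 : R)^'] --> a'.
  by case: da => d1 <-; exact: d1.
set g := fun h : R => h^-1 *: (flat i j l (a (h *: (1 : R) + t)) (b (h *: (1 : R) + t)) - 0).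
suff gn : `|g h| @[h --> (0 : R)^'] --> (0 : R) by exact: norm_cvg0 gn.
have bound0 : C * (`|h^-1 *: (a (h *: (1 : R) + t) - a t)|
    * `|a (h *: (1 : R) + t)|) @[h --> (0 : R)^'] --> C * (`|a'| * `|0 : R|).
  by apply: cvgMl_tmp; apply: cvgM; apply: cvg_norm.
rewrite normr0 !mulr0 in bound0.
apply: (squeeze_cvgr _ (cvg_cst (0:R)) bound0).
have il0 : - (i + l).+1%:R^-1 < 0 :> R by rewrite oppr_lt0 invr_gt0 ltr0n.
have nearab : \forall h \near (0 : R)^', a (h *: (1 : R) + t) < 0 ->
    0 < b (h *: (1 : R) + t) by exact: shift0 _ ab.
have small : \forall h \near (0 : R)^', - (i + l).+1%:R^-1 < a (h *: (1 : R) + t).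
  exact: a_lim _ (lt_nbhsr il0).
apply: filterS2 nearab small => h hab hs.
have Hh := HC (a (h *: (1 : R) + t)) (b (h *: (1 : R) + t)).
rewrite normr_ge0 /g -a0 !subr0 !normrZ /=.
apply: le_trans (ler_wpM2l (normr_ge0 _) (Hh hs hab)) _.
by rewrite -[a _ ^+ 2]ger0_norm ?sqr_ge0// normrX mulrCA expr2 -!mulrA.
Qed.

Lemma is_derive_flat i j l (a b : R -> R) (t a' b' : R) :
  is_derive t 1 a a' -> is_derive t 1 b b' ->
  (\forall s \near t, a s < 0 -> 0 < b s) ->
  is_derive t 1 (fun s => flat i j l (a s) (b s))
    (flat_derive i j l (a t) (b t) a' b').
Proof.
move=> da db ab; have [a0|a0] := leP 0 (a t).
  rewrite /flat_derive !flat_ge0// !mulr0 !(subr0, addr0) !mulr0 subr0.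
  exact: is_derive_flat_ge0 da ab a0.
by apply: is_derive_flat_lt0 => //; exact: (nbhs_singleton ab).
Qed.

(** This turns directional derivatives into derivatives of one variable, for
    which the rules for inverses and compositions are available. *)
Lemma is_derive_lineE n (f : 'rV[R]_n -> R) (x v : 'rV[R]_n) (d : R) :
  is_derive x v f d <-> is_derive (0 : R) 1 (fun s => f (s *: v + x)) d.
Proof.
have E : (fun h : R => h^-1 *: (((fun s => f (s *: v + x)) \o shift (0 : R)) (h *: (1 : R))
            - f ((0 : R) *: v + x))) =
    (fun h => h^-1 *: ((f \o shift x) (h *: v) - f x)).
  by apply/funext => h /=; rewrite addr0 scale0r add0r (_ : h *: 1 = h)//; exact: mulr1.
by split=> -[d1 d2]; apply: DeriveDef; move: d1 d2; rewrite /derivable /derive E.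
Qed.

Lemma is_derive_flat_direction n (U : set 'rV[R]_n) (a b : 'rV[R]_n -> R) i j l
    (v x : 'rV[R]_n) :
  open U -> (forall x, U x -> a x < 0 -> 0 < b x) -> U x ->
  derivable a x v -> derivable b x v ->
  is_derive x v (fun y => flat i j l (a y) (b y))
    (flat_derive i j l (a x) (b x) ('D_v a x) ('D_v b x)).
Proof.
move=> oU ab Ux /derivableP da /derivableP db; apply/is_derive_lineE.
rewrite -[X in a X](add0r x) -[X in b X](add0r x) -(scale0r v).
apply: (@is_derive_flat i j l (fun s : R => a (s *: v + x)) (fun s : R => b (s *: v + x))).
- exact/is_derive_lineE.
- exact/is_derive_lineE.
have lineC : (s *: v + x) @[s --> (0 : R)] --> x.
  have := cvgD (cvgZr_tmp (a := v) (@cvg_id _ (nbhs (0 : R)))) (cvg_cst x).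
  by rewrite scale0r add0r => H; exact: H.
have : \forall s \near (0 : R), U (s *: v + x).
  by apply: lineC; exact: open_nbhs_nbhs.
by apply: filterS => s; exact: ab.
Qed.

Lemma cvg_flat (T : Type) (F : set_system T) (FF : Filter F) i j l
    (a b : T -> R) (a0 b0 : R) :
  a @ F --> a0 -> b @ F --> b0 -> F [set s | a s < 0 -> 0 < b s] ->
  (a0 < 0 -> 0 < b0) ->
  flat i j l (a s) (b s) @[s --> F] --> flat i j l a0 b0.
Proof.
move=> aF bF ab ab0; have [a0_ge0|a0_lt0] := leP 0 a0.
  rewrite flat_ge0//.
  have [C C0 HC] := flat_bound i j l.
  suff gn : `|flat i j l (a s) (b s)| @[s --> F] --> (0 : R) by exact: norm_cvg0 gn.
  (* [`|a| - a] is continuous, vanishes for [a >= 0] and equals [2 `|a|]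
     for [a < 0]. *)
  have bound0 : C * (`|a s| - a s) ^+ 2 @[s --> F] --> C * (`|a0| - a0) ^+ 2.
    by apply: cvgMl_tmp; apply: cvgM; apply: cvgB => //; exact: cvg_norm.
  rewrite ger0_norm// subrr expr0n mulr0 in bound0.
  apply: (squeeze_cvgr _ (cvg_cst (0 : R)) bound0).
  have small : F [set s | - (i + l).+1%:R^-1 < a s].
    have il0 : - (i + l).+1%:R^-1 < 0 :> R by rewrite oppr_lt0 invr_gt0 ltr0n.
    exact: aF _ (lt_nbhsr (lt_le_trans il0 a0_ge0)).
  apply: filterS2 ab small => s abs smalls /=; rewrite normr_ge0 /=.
  have Hs := HC _ _ smalls abs.
  have [as0|as0] := leP 0 (a s).
    by rewrite flat_ge0// normr0 mulr_ge0 ?sqr_ge0.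
  by rewrite (le_trans Hs)// ler_wpM2l// ltr0_norm//; nra.
have nearF : F [set s | a s < 0] by exact: (aF _ (lt_nbhsl a0_lt0)).
have aV : (a s)^-1 @[s --> F] --> a0^-1 by apply: cvgV => //; rewrite lt_eqF.
have bV : (b s)^-1 @[s --> F] --> b0^-1 by apply: cvgV => //; rewrite gt_eqF ?ab0.
have L_lim : b s - ln (b s) @[s --> F] --> b0 - ln b0.
  by apply: cvgB => //; exact: continuous_cvg (continuous_ln (ab0 a0_lt0)) bF.
have X_lim (f : T -> R) (c : R) k : f @ F --> c -> f s ^+ k @[s --> F] --> c ^+ k.
  by move=> fc; exact: (cvg_comp f (fun x : R => x ^+ k) fc (@exprn_continuous R k c)).
rewrite [flat i j l a0 b0]/flat a0_lt0.
have E_lim : expR ((b s - ln (b s)) * (a s)^-1) @[s --> F]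
    --> expR ((b0 - ln b0) * a0^-1).
  by apply: continuous_cvg; [exact: continuous_expR|exact: cvgM].
have H : (b s)^-1 ^+ i * (a s)^-1 ^+ j * (b s - ln (b s)) ^+ l
    * expR ((b s - ln (b s)) * (a s)^-1) @[s --> F]
    --> b0^-1 ^+ i * a0^-1 ^+ j * (b0 - ln b0) ^+ l * expR ((b0 - ln b0) * a0^-1).
  by apply: cvgM E_lim; apply: cvgM; [apply: cvgM|]; exact: X_lim.
apply: cvg_trans H; apply: near_eq_cvg; apply: filterS nearF => s as0.
by rewrite /flat as0.
Qed.

(** Each partial derivative is a combination of members of the same family with
    smooth coefficients, so the induction on [k] runs over all indices at
    once. *)
Lemma Ck_flat n k (U : set 'rV[R]_n) (a b : 'rV[R]_n -> R) i j l :
  open U -> smooth_on U a -> smooth_on U b ->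
  (forall x, U x -> a x < 0 -> 0 < b x) ->
  Ck k U (fun x => flat i j l (a x) (b x)).
Proof.
move=> oU sa sb ab.
have flat_cont i' j' l' x : U x ->
    {for x, continuous (fun x => flat i' j' l' (a x) (b x))}.
  move=> Ux; apply: (@cvg_flat _ (nbhs x) (nbhs_filter x)).
  - exact: (Ck_continuous (sa 0) Ux).
  - exact: (Ck_continuous (sb 0) Ux).
  - by apply: filterS (open_nbhs_nbhs (conj oU Ux)) => y; exact: ab.
  - exact: ab.
elim: k i j l => [|k IH] i j l; split=> //; try by move=> x; exact: flat_cont.
move=> m.
have [_ /(_ m)[da sda]] := sa k.+1.
have [_ /(_ m)[db sdb]] := sb k.+1.
have dflat x (Ux : U x) := is_derive_flat_direction i j l oU ab Ux (da x Ux) (db x Ux).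
split; first by move=> x /dflat[].
pose df x := flat_derive i j l (a x) (b x) (partial m a x) (partial m b x).
apply: (@Ck_eq _ _ _ _ df) => // [x Ux|]; first by rewrite /df; have [_ <-] := dflat x Ux.
rewrite /df /flat_derive.
have CkN f : Ck k U f -> Ck k U (fun x => - f x).
  move=> fk; apply: (Ck_eq oU) (CkM oU (Ck_cst k U (-1)) fk) => x _.
  by rewrite mulN1r.
have CkZ c f : Ck k U f -> Ck k U (fun x => c * f x).
  by move=> fk; exact: CkM oU (Ck_cst k U c) fk.
have CkB f g : Ck k U f -> Ck k U g -> Ck k U (fun x => f x - g x).
  by move=> fk /CkN; exact: CkD.
apply: (CkB); apply: (CkM oU) => //; last by apply: (CkD oU) => //; exact: CkZ.
apply: (CkB) => //; apply: (CkD oU) => //; apply: (CkB); last exact: CkZ.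
by apply: (CkD oU); exact: CkZ.
Qed.

End Flat.

(** * Half-integral powers are not smooth *)

Section Singular.
Variable R : realType.

(** The operator [g |-> dg/dy + al g] preserves smoothness and maps
    [c y^s exp(-al y)] to [c s y^(s - 1) exp(-al y)]. Starting from a
    half-integral exponent it never meets [s = 0], so after [n] steps a smooth
    function equals a multiple of [y^(-1/2) exp(-al y)] for small [y > 0]; being
    bounded near [y = 0], it forces [c = 0]. *)
Lemma half_power_not_smooth (f : 'rV[R]_2 -> R) (x al c d : R) n :
  smooth_on setT f -> 0 < d ->
  (forall y, 0 < y < d -> f (y *: 'e_1 + x *: 'e_0) =
     c * expR ((n%:R - 2^-1) * ln y - al * y)) ->
  c = 0.
Proof.
move=> + d0; elim: n f c => [|n IH] f c fs fE.
  have fc : f (y *: 'e_1 + x *: 'e_0) @[y --> (0 : R)^'+] --> f ((0 : R) *: 'e_1 + x *: 'e_0).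
    apply: continuous_cvg; first exact: (Ck_continuous (fs 0)).
    apply: cvg_at_right_filter.
    have := cvgD (cvgZr_tmp (a := 'e_1 : 'rV[R]_2) (@cvg_id _ (nbhs (0 : R)))) (cvg_cst (x *: 'e_0)).
    exact.
  have idc : y @[y --> (0 : R)^'+] --> (0 : R) by apply: cvg_at_right_filter; exact: cvg_id.
  (* Squaring avoids the root: [f^2 y = (c exp(-al y))^2] for [0 < y < d], and
     both sides are continuous at zero, with limits [0] and [c^2]. *)
  have lhs : f (y *: 'e_1 + x *: 'e_0) * f (y *: 'e_1 + x *: 'e_0) * y
      @[y --> (0 : R)^'+]
      --> f ((0 : R) *: 'e_1 + x *: 'e_0) * f ((0 : R) *: 'e_1 + x *: 'e_0) * 0.
    exact: (cvgM (cvgM fc fc) idc).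
  have rhs : (c * expR (- al * y)) * (c * expR (- al * y)) @[y --> (0 : R)^'+]
      --> (c * expR (- al * 0)) * (c * expR (- al * 0)).
    have H : c * expR (- al * y) @[y --> (0 : R)^'+] --> c * expR (- al * 0).
      apply: cvgMl_tmp; apply: continuous_cvg; first exact: continuous_expR.
      exact: cvgMl_tmp.
    exact: (cvgM H H).
  have E : \forall y \near (0 : R)^'+,
      f (y *: 'e_1 + x *: 'e_0) * f (y *: 'e_1 + x *: 'e_0) * y =
      (c * expR (- al * y)) * (c * expR (- al * y)).
    have ypos : \forall y \near (0 : R)^'+, 0 < y by exact: nbhs_right_gt.
    have yd : \forall y \near (0 : R)^'+, y < d by exact: nbhs_right_lt.
    apply: filterS2 ypos yd => y y0 yd; rewrite fE ?y0//.
    rewrite sub0r expRD (_ : - (al * y) = - al * y); last by rewrite mulNr.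
    set e := expR (- al * y); set r := expR _.
    have : r * r * y = 1.
      rewrite /r -expRD -[X in _ * X](lnK (y0 : y \in Num.pos)) -expRD.
      by rewrite -[RHS]expR0; congr expR; field.
    by move=> ry; rewrite -[RHS]mul1r -ry; ring.
  have /= := cvg_unique (@norm_hausdorff _ _) (cvg_trans (near_eq_cvg E) lhs) rhs.
  rewrite !mulr0 expR0 mulr1 => /(_ _ _)/esym/eqP.
  by rewrite mulf_eq0 orbb => /eqP.
have [_ /(_ 1)[fd _]] := fs 1%N.
have : c * (n.+1%:R - 2^-1) = 0.
  apply: (IH (fun z => partial 1 f z + al * f z)).
    move=> k; apply: CkD; first exact: openT.
      by have [_ /(_ 1)[_]] := fs k.+1.
    by apply: CkM; [exact: openT|exact: Ck_cst|exact: fs].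
  move=> y /andP[y0 yd].
  rewrite /partial; have /is_derive_line[_ <-] := fd (y *: 'e_1 + x *: 'e_0) I.
  have nE : \forall s \near y, c * expR ((n.+1%:R - 2^-1) * ln s - al * s) =
      f (s *: 'e_1 + x *: 'e_0).
    have ypos : \forall s \near y, 0 < s by exact: lt_nbhsr.
    have ysd : \forall s \near y, s < d by exact: lt_nbhsl.
    by apply: filterS2 ypos ysd => s s0 sd; rewrite fE ?s0.
  rewrite -(near_eq_derive _ nE).
  have dexp : is_derive y 1 (fun s => c * expR ((n.+1%:R - 2^-1) * ln s - al * s))
      (c * (expR ((n.+1%:R - 2^-1) * ln y - al * y) * ((n.+1%:R - 2^-1) * y^-1 - al))).
    have dl := is_derive1_ln y0.
    have H := is_deriveZ c (is_derive1_comp (is_derive_expR _)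
     (is_deriveB (is_deriveZ (n.+1%:R - 2^-1) dl) (is_deriveZ al (is_derive_id y 1)))).
    apply: is_derive_eq H _; rewrite /GRing.scale /=.
    by rewrite mulr1.
  rewrite derive_val fE ?y0//.
  have -> : expR ((n%:R - 2^-1) * ln y - al * y) =
      expR ((n.+1%:R - 2^-1) * ln y - al * y) * y^-1.
    rewrite -[y^-1]lnK ?posrE ?invr_gt0// -expRD lnV ?posrE// -natr1.
    by congr expR; ring.
  by ring.
move=> /eqP; rewrite mulf_eq0 => /orP[/eqP//|].
have : (1 : R) <= n.+1%:R by rewrite ler1n.
by move=> H /eqP H0; lra.
Qed.

End Singular.

(** * The witness on the half plane *)

Section HalfPlane.
Variable R : realType.
Let F := sub_sikorski (cartesian_sikorski R 2) (half_plane R).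

Definition half_plane_flat (v : half_plane R) : R :=
  flat 0 0 0 (val v 0 0) (val v 0 1).

Lemma plot_half_plane_coord n (U : opens R n) (p : U -> half_plane R) (i : 'I_2) :
  plot (Pi F) p -> smooth_fun (fun u => val (p u) 0 i).
Proof.
move=> pF; apply: (pF (fun v : half_plane R => val v 0 i)) => v.
exists setT, (fun x : 'rV[R]_2 => x 0 i); split=> //; first exact: filterT.
exact: smooth_coord.
Qed.

(** On a plot the second coordinate is positive wherever the first one is
    negative, because the space omits the negative half of the axis. *)
Lemma half_plane_flat_Phi_Pi : sikorski_fun (Phi (Pi F)) half_plane_flat.
Proof.
move=> n U p pF.
have [a sa pa] := plot_half_plane_coord 0 pF.
have [b sb pb] := plot_half_plane_coord 1 pF.
exists (fun x => flat 0 0 0 (a x) (b x)).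
  move=> k; apply: Ck_flat => //; first exact: opensP.
  move=> x Ux a0.
  pose u : U := exist _ x (mem_set Ux).
  have : half_plane R (val (p u)) := set_valP (p u).
  by rewrite /half_plane /= pa pb => -[//|[_]]; rewrite /= leNgt a0.
by move=> u /=; rewrite /half_plane_flat pa pb.
Qed.

Lemma half_plane_flat_notin : ~ sikorski_fun F half_plane_flat.
Proof.
have half0 : half_plane R 0 by right; rewrite /= !mxE.
move=> /(_ (exist _ 0 (mem_set half0)))[W [g [W0 gs gf]]].
have : nbhs (0 : 'rV[R]_2) W.
  apply: (@sikorski_nbhs _ _ _ (nbhs (0 : 'rV[R]_2)) 0) W0 => h hs.
  exact: (Ck_continuous (hs 0)).
move=> /nbhs_ballP[d /= d0 Wd].
(* The vertical line [x = -1 / al] must meet the ball of radius [d], and [al]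
   must be half an odd integer. *)
pose n := (Num.truncn d^-1).+1.
pose al : R := n.+1%:R - 2^-1.
have ald : d^-1 < al.
  have dn : d^-1 < n%:R := truncnS_gt _.
  by rewrite /al -natr1; lra.
have al0 : 0 < al by rewrite (lt_trans _ ald)// invr_gt0.
suff : (1 : R) = 0 by apply/eqP; rewrite oner_eq0.
apply: (@half_power_not_smooth R g (- al^-1) al 1 d n.+1) => // y /andP[y0 yd].
have vE (i : 'I_2) : (y *: 'e_1 + - al^-1 *: 'e_0 : 'rV[R]_2) 0 i = if i == 0 then - al^-1 else y.
  by rewrite !mxE /=; case: i => -[|[|//]] ? /=; rewrite ?mulr0 ?mulr1 ?addr0 ?add0r.
have Xv : half_plane R (y *: 'e_1 + - al^-1 *: 'e_0) by left; rewrite /= vE.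
pose w : half_plane R := exist _ (y *: 'e_1 + - al^-1 *: 'e_0) (mem_set Xv).
have -> : g (y *: 'e_1 + - al^-1 *: 'e_0) = half_plane_flat w.
  apply: (gf w).
  apply: Wd; rewrite -ball_normE /= sub0r normrN.
  rewrite [ltLHS]/Num.Def.normr/= mx_normrE bigmax_lt// => -[i j] _ /=.
  rewrite ord1 vE; case: ifP => _; rewrite ?normrN gtr0_norm ?invr_gt0//.
  by rewrite -[ltRHS]invrK ltf_pV2 ?posrE// invr_gt0.
rewrite /half_plane_flat /= !vE /= /flat oppr_lt0 invr_gt0 al0 !expr0 !mul1r.
by rewrite invrN invrK; congr expR; rewrite -/al; ring.
Qed.

End HalfPlane.

Theorem corollary3p2 (R : realType) :
  ~ sikorski_reflexive (sub_sikorski (cartesian_sikorski R 2) (half_plane R)).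
Proof.
move=> refl; apply: (@half_plane_flat_notin R).
by rewrite -refl; exact: half_plane_flat_Phi_Pi.
Qed.
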